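(* Let $\mathfrak g$ be a non-abelian nilpotent real Lie algebra of real dimension $2n\ge 8$ endowed with a quasi-nilpotent complex structure $J$. Then $(\mathfrak g,J)$ does not admit any $2$-Kähler structure.
   Context: A complex structure on a real Lie algebra $\mathfrak g$ is an endomorphism $J$ with $J^2=-\mathrm{Id}$ that is integrable (vanishing Nijenhuis tensor); $d$ denotes the Chevalley–Eilenberg differential. Quasi-nilpotent: for a complex structure $J$ on a nilpotent Lie algebra $\mathfrak g$ put $\mathfrak a_0(J)=\{0\}$ and $\mathfrak a_k(J)=\{X\in\mathfrak g: [X,\mathfrak g]\subseteq\mathfrak a_{k-1}(J),\ [JX,\mathfrak g]\subseteq\mathfrak a_{k-1}(J)\}$ for $k\ge1$. $J$ is quasi-nilpotent if $\mathfrak a_1(J)\ne\{0\}$ (equivalently, the center of $\mathfrak g$ contains a non-trivial $J$-invariant subspace). Positivity. Let $V$ be a complex vector space of dimension $n$ and $\Lambda^{p,q}$ the space of $(p,q)$-forms on $V$. An $(n,n)$-form $\nu$ is positive if $\nu=c\,i\alpha^1\wedge\overline{\alpha^1}\wedge\cdots\wedge i\alpha^n\wedge\overline{\alpha^n}$ with $c\in\mathbb R_{\ge0}$ and $\{\alpha^j\}$ a basis of $\Lambda^{1,0}$; it is a volume form if $c>0$. A $(q,0)$-form is simple if it is of the form $\mu_1\wedge\dots\wedge\mu_q$ with $\mu_j\in\Lambda^{1,0}$. A $(k,k)$-form $\Omega$ is transverse if for every non-zero simple $(n-k,0)$-form $\psi$ the $(n,n)$-form $i^{(n-k)^2}\,\Omega\wedge\psi\wedge\bar\psi$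 is a volume form. A $p$-Kähler structure on a Lie algebra with complex structure $(\mathfrak g,J)$ of complex dimension $n$ ($1\le p<n$) is a real transverse $(p,p)$-form $\Omega$ on $(\mathfrak g,J)$ (a complex vector space via $J$) with $d\Omega=0$. *)

(* Defs.v *)
From HB Require Import structures.
From mathcomp Require Import all_boot all_order all_algebra.
From mathcomp Require Import complex.
From mathcomp Require Import boolp classical_sets reals.

Set Implicit Arguments.
Unset Strict Implicit.
Unset Printing Implicit Defensive.

Import Order.TTheory GRing.Theory Num.Theory.

Local Open Scope classical_set_scope.
Local Open Scope ring_scope.
Local Open Scope complex_scope.

Record lie_bracket (R : realType) (V : vectType R) := LieBracket {
  bracket :> V -> V -> V;
  bracket_linearl : forall a x y z,
    bracket (a *: x + y) z = a *: bracket x z + bracket y z;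
  bracket_linearr : forall a x y z,
    bracket x (a *: y + z) = a *: bracket x y + bracket x z;
  bracket_alt : forall x, bracket x x = 0;
  bracket_jacobi : forall x y z,
    bracket x (bracket y z) + bracket y (bracket z x)
      + bracket z (bracket x y) = 0 }.

Section LieAlgebra.
Variables (R : realType) (V : vectType R) (b : lie_bracket V).

Definition abelian_lie := forall x y, b x y = 0.

(* By bilinearity, brackets of basis vectors span [V, lower_central k]. *)
Fixpoint lower_central (k : nat) : {vspace V} :=
  if k is k'.+1 then
    <<[seq b x y | x <- vbasis {:V}, y <- vbasis (lower_central k')]>>%VS
  else {:V}%VS.

Definition nilpotent_lie := exists k, lower_central k = 0%VS.

Definition nijenhuis (J : 'End(V)) (x y : V) : V :=
  b (J x) (J y) - J (b (J x) y) - J (b x (J y)) - b x y.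

Record complex_structure := ComplexStructure {
  cplx :> 'End(V);
  cplx_sq : forall x, cplx (cplx x) = - x;
  cplx_integrable : forall x y, nijenhuis cplx x y = 0 }.

Fixpoint a_series (J : complex_structure) (k : nat) : set V :=
  if k is k'.+1 then
    [set x | (forall y, a_series J k' (b x y)) /\
             (forall y, a_series J k' (b (J x) y))]
  else [set 0].

Definition quasi_nilpotent (J : complex_structure) :=
  a_series J 1 <> [set 0].

End LieAlgebra.

Section Forms.
Variables (R : realType) (V : vectType R).

(* Complex-valued forms of all degrees on V share one type, so that wedge
   products need no casts between degrees: a form is evaluated on a list of
   vectors, and a form of degree k vanishes on the lists of length <> k. *)
Definition ext_form := seq V -> R[i].

Definition is_form (k : nat) (w : ext_form) :=
  [/\ forall s, size s <> k -> w s = 0,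
      forall s1 s2 (a : R) x y,
        w (s1 ++ (a *: x + y) :: s2)
          = a%:C * w (s1 ++ x :: s2) + w (s1 ++ y :: s2) &
      forall s1 s2 s3 x, w (s1 ++ x :: s2 ++ x :: s3) = 0].

Definition form_one : ext_form := fun s => (size s == 0%N)%:R.

Definition form_scale (c : R[i]) (w : ext_form) : ext_form := fun s => c * w s.

Definition form_conj (w : ext_form) : ext_form := fun s => (w s)^*.

Definition inversions (m : bitseq) : nat :=
  \sum_(i < size m) \sum_(j < size m)
    [&& (i < j)%N, ~~ nth false m i & nth false m j].

(* Sum over shuffles: m selects the arguments given to w1, the remaining ones
   go to w2, and inversions m is the number of inversions of this shuffle.
   Hence (alpha ^ beta)(x, y) = alpha x * beta y - alpha y * beta x. *)
Definition wedge (w1 w2 : ext_form) : ext_form := fun s =>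
  \sum_(m : (size s).-tuple bool)
    (-1) ^+ inversions m * w1 (mask m s) * w2 (mask (map negb m) s).

Definition wedge_prod (k : nat) (a : 'I_k -> ext_form) : ext_form :=
  \big[wedge/form_one]_(j < k) a j.

Definition del2 (i j : nat) (s : seq V) : seq V :=
  mask [seq (l != i) && (l != j) | l <- iota 0 (size s)] s.

(* Chevalley-Eilenberg differential: (d w)(x_0, ..., x_k) is the sum over i < j
   of (-1)^(i+j) w([x_i, x_j], x_0, ..., x_k with x_i and x_j omitted). *)
Definition ce_diff (b : lie_bracket V) (w : ext_form) : ext_form := fun s =>
  \sum_(i < size s) \sum_(j < size s | (i < j)%N)
    (-1) ^+ (i + j) * w (b (nth 0 s i) (nth 0 s j) :: del2 i j s).

Variable J : 'End(V).

Definition form10 (a : ext_form) :=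
  is_form 1 a /\ forall x, a [:: J x] = 'i * a [:: x].

(* Linear span of a_1 ^ ... ^ a_p ^ conj b_1 ^ ... ^ conj b_q with a_j, b_j
   of type (1,0). *)
Definition pq_form (p q : nat) (w : ext_form) :=
  exists (N : nat) (c : 'I_N -> R[i])
    (a : 'I_N -> 'I_p -> ext_form) (b : 'I_N -> 'I_q -> ext_form),
  [/\ forall r j, form10 (a r j),
      forall r j, form10 (b r j) &
      forall s, w s = \sum_(r < N)
        c r * wedge (wedge_prod (a r))
                    (wedge_prod (fun j => form_conj (b r j))) s].

Definition form10_basis (n : nat) (a : 'I_n -> ext_form) :=
  (forall j, form10 (a j)) /\
  (forall w, form10 w ->
     exists! c : 'rV[R[i]]_n, forall s, w s = \sum_(j < n) c 0 j * a j s).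

Definition volume_form (n : nat) (nu : ext_form) :=
  exists (c : R) (a : 'I_n -> ext_form),
  [/\ 0 < c, form10_basis a &
      nu =1 form_scale c%:C
        (wedge_prod (fun j => form_scale 'i (wedge (a j) (form_conj (a j)))))].

Definition simple_form (q : nat) (psi : ext_form) :=
  exists mu : 'I_q -> ext_form,
    (forall j, form10 (mu j)) /\ psi =1 wedge_prod mu.

Definition nonzero_form (w : ext_form) := exists s, w s != 0.

(* Here and below n is the complex dimension of (V, J). *)
Definition transverse (n k : nat) (Om : ext_form) :=
  forall psi, simple_form (n - k) psi -> nonzero_form psi ->
    volume_form n
      (form_scale ('i ^+ ((n - k) ^ 2)) (wedge (wedge Om psi) (form_conj psi))).

Definition real_form (w : ext_form) := form_conj w =1 w.

End Forms.

Definition p_kahler (R : realType) (V : vectType R) (b : lie_bracket V)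
    (J : complex_structure b) (n p : nat) (Om : ext_form V) :=
  (1 <= p < n)%N /\
  [/\ pq_form J p p Om, real_form Om, transverse J n p Om &
      forall s, ce_diff b Om s = 0].

(* Main.v *)
From HB Require Import structures.
Require Import Defs.
From mathcomp Require Import all_boot all_order all_algebra.
From mathcomp Require Import ring lra zify.
From mathcomp Require Import complex.
From mathcomp Require Import boolp classical_sets reals.

(** Why the theorem is true.  Quasi-nilpotency gives [X != 0] such that [X]
    and [J X] are central; let [I] be the complex line that they span, a
    central ideal, and suppose that a 2-Kähler form [Om] exists.

    1. [om y z = Om (X, J X, y, z)] is a closed real [J]-invariant 2-form:
    closed because contraction with a central vector commutes, up to sign, with
    the differential, and [J]-invariant because [Om] has type (2,2).  Its
    radical contains [I], and transversality gives [om y (J y) != 0] for [y]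
    outside [I] ([transverse_neq0]): if [om y (J y)] were zero, choose [n - 2]
    forms of type (1,0) that vanish on the complex plane spanned by [X] and [y]
    and have a nonzero product [psi]; then [Om ^ psi ^ conj psi] would vanish
    on every list of vectors that starts with [X, J X, y, J y], and a form of
    top degree with this property is zero ([top_form_eq0]), whereas a volume
    form is not ([volume_form_neq0]).

    2. Thus [om] is, up to sign, a Kähler form on the nilpotent Lie algebra [g / I], and this
    forces [g / I] to be abelian ([kahler_nilpotent]).  This is the theorem of
    Benson-Gordon and Hasegawa, for which there is a short argument when the
    complex structure and the form are both left-invariant
    ([definite_kahler_nilpotent]): take an orthonormal basis [(e_i)] of [g / I]
    in which every [ad x] is strictly triangular.  The sum [H] of the
    [[e_i, J e_i]] is zero modulo [I], as closedness expresses [om (H, J u)] by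
    traces of [ad (J u)].  If [z] is central modulo [I], then [D = ad (J z)]
    commutes with [J] modulo [I] and is a derivation; pairing [D H = 0] with [z]
    shows that the sum of the squares of the [D e_i] is zero.  So [J z] is also
    central modulo [I], and closedness makes [z] orthogonal to [[g, g]].
    Were [[g, g]] not contained in [I], the descending central series would
    give such a [z] inside [[g, g]] and outside [I], orthogonal to itself.

    3. Hence [[g, g]] is contained in [I]; let [beta] and [gamma] be the
    coordinates of the bracket along [X] and [J X].  Contracting [d Om = 0]
    with [J X] and with [X] gives [beta ^ om = 0] and [gamma ^ om = 0].  On
    [g / I], of real dimension at least 6, the wedge product with the
    nondegenerate [om] is injective on 2-forms ([lefschetz_injective2]).
    So the bracket is zero, contrary to hypothesis. *)

Set Implicit Arguments.
Unset Strict Implicit.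
Unset Printing Implicit Defensive.

Import Order.TTheory GRing.Theory Num.Theory.

Local Open Scope ring_scope.
Local Open Scope complex_scope.

(** * Exterior products as shuffle sums *)

Section Exterior.
Variables (R : realType) (V : vectType R).
Implicit Types (w : ext_form V) (s t : seq V) (x y v : V).

Definition contract x w : ext_form V := fun s => w (x :: s).

(** On a [k]-form this is multiplication by [(-1) ^ k]: the sign of the graded
    Leibniz rule, written so that no degree has to be known. *)
Definition signed w : ext_form V := fun s => (-1) ^+ size s * w s.

Lemma inversions_cons (c : bool) (m : bitseq) :
  inversions (c :: m) = ((~~ c) * count id m + inversions m)%N.
Proof.
rewrite /inversions /= big_ord_recl /= big_ord_recl /= add0n; congr addn.
  rewrite -sum1_count (big_nth false) big_mkord big_distrr /= [RHS]big_mkcond /=.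
  apply: eq_bigr => i _; rewrite add0n.
  by case: c; case: (nth false m i).
apply: eq_bigr => i _; rewrite big_ord_recl /= add0n.
by apply: eq_bigr => j _; rewrite /bump !add1n ltnS.
Qed.

Lemma wedge_nil w1 w2 : wedge w1 w2 [::] = w1 [::] * w2 [::].
Proof.
rewrite /wedge (big_pred1 [tuple]) /=; last by move=> m; rewrite [m]tuple0 /= eqxx.
by rewrite /inversions big_ord0 expr0 mul1r.
Qed.

(** The graded Leibniz rule for the contraction with [x].  A shuffle either
    gives the first vector to [w1], or gives it to [w2] and then makes an
    inversion with every argument of [w1].  All later facts on [wedge] are
    inductions based on this recursion. *)
Lemma wedge_cons w1 w2 x s : wedge w1 w2 (x :: s)
  = wedge (contract x w1) w2 s + wedge (signed w1) (contract x w2) s.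
Proof.
pose F (p : bool * (size s).-tuple bool) : (size s).+1.-tuple bool :=
  [tuple of p.1 :: p.2].
pose G (m : (size s).+1.-tuple bool) : bool * (size s).-tuple bool :=
  (thead m, [tuple of behead m]).
have FK : cancel F G by case=> c m; congr pair; apply/val_inj.
have GK : cancel G F by move=> m; rewrite [RHS]tuple_eta; apply/val_inj.
rewrite {1}/wedge /= (reindex F) /=; last by exists G => m _; rewrite ?FK ?GK.
rewrite -(pair_bigA _ (fun (c : bool) (m : (size s).-tuple bool) =>
  (-1) ^+ inversions (c :: m) * w1 (mask (c :: m) (x :: s)) *
    w2 (mask (~~ c :: map negb m) (x :: s)))) /= big_bool; congr (_ + _).
  by apply: eq_bigr => m _; rewrite inversions_cons /= mul0n.
apply: eq_bigr => m _; rewrite inversions_cons /= mul1n exprD.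
rewrite /signed /contract size_mask ?size_tuple //.
by rewrite mulrA [_ * (-1) ^+ count _ _]mulrC.
Qed.

Lemma wedge_linl w1 w2 w3 w' (c : R[i]) s :
  (forall t, w1 t = c * w2 t + w3 t) ->
  wedge w1 w' s = c * wedge w2 w' s + wedge w3 w' s.
Proof.
move=> h; rewrite /wedge big_distrr -big_split /=.
by apply: eq_bigr => m _; rewrite h; ring.
Qed.

Lemma wedge_linr w1 w2 w3 w' (c : R[i]) s :
  (forall t, w1 t = c * w2 t + w3 t) ->
  wedge w' w1 s = c * wedge w' w2 s + wedge w' w3 s.
Proof.
move=> h; rewrite /wedge big_distrr -big_split /=.
by apply: eq_bigr => m _; rewrite h; ring.
Qed.

Lemma wedge0l w1 w2 s : (forall t, w1 t = 0) -> wedge w1 w2 s = 0.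
Proof. by move=> h; apply: big1 => m _; rewrite h mulr0 mul0r. Qed.

Lemma wedge0r w1 w2 s : (forall t, w2 t = 0) -> wedge w1 w2 s = 0.
Proof. by move=> h; apply: big1 => m _; rewrite h mulr0. Qed.

Lemma eq_wedge w1 w2 w1' w2' s : w1 =1 w1' -> w2 =1 w2' ->
  wedge w1 w2 s = wedge w1' w2' s.
Proof. by move=> h1 h2; apply: eq_bigr => m _; rewrite h1 h2. Qed.

Lemma wedge1l w s : wedge (@form_one R V) w s = w s.
Proof.
elim: s w => [|x s IH] w; first by rewrite wedge_nil /form_one mul1r.
rewrite wedge_cons wedge0l ?add0r // -[RHS](IH (contract x w)); apply: eq_wedge => // t.
by rewrite /signed /form_one; case: t => [|y t]; rewrite ?expr0 ?mul1r ?mulr0.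
Qed.

(** A vector annihilated by [w2] has to be an argument of [w1]. *)
Lemma wedge_contractl w1 w2 x s : (forall t, w2 (x :: t) = 0) ->
  wedge w1 w2 (x :: s) = wedge (contract x w1) w2 s.
Proof. by move=> h; rewrite wedge_cons [X in _ + X]wedge0r ?addr0. Qed.

Definition multilinear w := forall s1 s2 (a : R) x y,
  w (s1 ++ (a *: x + y) :: s2) = a%:C * w (s1 ++ x :: s2) + w (s1 ++ y :: s2).

Definition skew w := forall s1 s2 x y,
  w (s1 ++ x :: y :: s2) = - w (s1 ++ y :: x :: s2).

Definition homogeneous k w := forall s, size s <> k -> w s = 0.

Lemma contract_multilinear x w : multilinear w -> multilinear (contract x w).
Proof. by move=> h s1 s2 a y z; apply: (h (x :: s1)). Qed.

Lemma contract_skew x w : skew w -> skew (contract x w).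
Proof. by move=> h s1 s2 y z; apply: (h (x :: s1)). Qed.

Lemma signed_multilinear w : multilinear w -> multilinear (signed w).
Proof. by move=> h s1 s2 a x y; rewrite /signed h !size_cat /=; ring. Qed.

Lemma signed_skew w : skew w -> skew (signed w).
Proof. by move=> h s1 s2 x y; rewrite /signed h !size_cat /=; ring. Qed.

Lemma wedge_multilinear w1 w2 :
  multilinear w1 -> multilinear w2 -> multilinear (wedge w1 w2).
Proof.
move=> + + s1; elim: s1 w1 w2 => [|z s1 IH] w1 w2 h1 h2 s2 a x y /=.
  rewrite !wedge_cons.
  rewrite (@wedge_linl _ _ _ _ a%:C _ (fun t => h1 [::] t a x y)).
  rewrite (@wedge_linr _ _ _ _ a%:C _ (fun t => h2 [::] t a x y)).
  rewrite /contract /=; ring.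
rewrite !wedge_cons !IH; first by ring.
all: solve [exact: signed_multilinear | exact: contract_multilinear | by []].
Qed.

(** Contracting twice by the Leibniz rule, the two mixed terms are exchanged
    with opposite signs when [x] and [y] are swapped. *)
Lemma wedge_skew w1 w2 : skew w1 -> skew w2 -> skew (wedge w1 w2).
Proof.
move=> + + s1; elim: s1 w1 w2 => [|z s1 IH] w1 w2 h1 h2 s2 x y /=.
  rewrite !wedge_cons.
  have E u v : wedge (contract v (signed w1)) (contract u w2) s2
      = - wedge (signed (contract v w1)) (contract u w2) s2.
    rewrite (@wedge_linl _ (signed (contract v w1)) (fun=> 0) _ (-1)).
      by rewrite (@wedge0l (fun=> 0)) // addr0 mulN1r.
    by move=> t; rewrite /contract /signed /= exprS; ring.
  rewrite !E.
  rewrite (@wedge_linl _ (contract x (contract y w1)) (fun=> 0) _ (-1)).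
    rewrite (@wedge_linr (contract y (contract x w2))
             (contract x (contract y w2)) (fun=> 0) _ (-1)).
      by rewrite (@wedge0l (fun=> 0)) // (@wedge0r _ (fun=> 0)) //; ring.
    by move=> t; rewrite /contract (h2 [::]) /=; ring.
  by move=> t; rewrite /contract (h1 [::]) /=; ring.
rewrite !wedge_cons opprD; congr (_ + _); apply: IH => //.
- exact: contract_skew.
- exact: signed_skew.
- exact: contract_skew.
Qed.

Lemma wedge_homogeneous k l w1 w2 :
  homogeneous k w1 -> homogeneous l w2 -> homogeneous (k + l) (wedge w1 w2).
Proof.
move=> h1 h2 s hs; apply: big1 => m _.
have [e1|/eqP/h1->] := eqVneq (size (mask m s)) k; last by rewrite mulr0 mul0r.
rewrite h2 ?mulr0 // => e2; apply: hs; rewrite -e1 -e2.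
by rewrite !size_mask ?size_map ?size_tuple // count_map count_predC size_tuple.
Qed.

Lemma form_skew k w : is_form k w -> skew w.
Proof.
case=> _ hl ha s1 s2 x y.
have E u v : w (s1 ++ (u + v) :: (u + v) :: s2)
   = w (s1 ++ u :: u :: s2) + w (s1 ++ u :: v :: s2)
     + w (s1 ++ v :: u :: s2) + w (s1 ++ v :: v :: s2).
  have D s3 t1 p q : w (s3 ++ (p + q) :: t1) = w (s3 ++ p :: t1) + w (s3 ++ q :: t1).
    by rewrite -{1}(scale1r p) hl mul1r.
  have D2 z : w (s1 ++ z :: (u + v) :: s2)
      = w (s1 ++ z :: u :: s2) + w (s1 ++ z :: v :: s2).
    by rewrite -cat_rcons D !cat_rcons.
  by rewrite D !D2; ring.
have A u : w (s1 ++ u :: u :: s2) = 0 by apply: (ha s1 [::] s2).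
have := A (x + y); rewrite E !A add0r addr0 => /eqP.
by rewrite addr_eq0 => /eqP.
Qed.

Lemma skew_rotate w s1 s2 x : skew w ->
  w (s1 ++ x :: s2) = (-1) ^+ size s1 * w (x :: s1 ++ s2).
Proof.
move=> h; elim: s1 w h => [|y s1 IH] w h /=; first by rewrite expr0 mul1r.
have -> : w (y :: s1 ++ x :: s2) = contract y w (s1 ++ x :: s2) by [].
rewrite IH; last exact: contract_skew.
by rewrite /contract (h [::]) exprS /=; ring.
Qed.

(** Adjacent transpositions suffice, and this form of the alternation is the
    one that goes through an induction on the list of arguments. *)
Lemma formE k w : is_form k w <-> [/\ homogeneous k w, multilinear w & skew w].
Proof.
split=> [h|[h1 h2 h3]]; first by case: (h) => h1 h2 h3; split=> //; exact: form_skew h.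
split=> // s1 s2 s3 x.
have w0 u : w (x :: x :: u) = 0.
  by have /eqP := h3 [::] u x x; rewrite -addr_eq0 -mulr2n mulrn_eq0 => /eqP.
rewrite skew_rotate // -[x :: s1 ++ _]/((x :: s1) ++ _) catA skew_rotate //=.
by rewrite -catA w0 !mulr0.
Qed.

Lemma wedge_form k l w1 w2 :
  is_form k w1 -> is_form l w2 -> is_form (k + l) (wedge w1 w2).
Proof.
move=> /formE[? ? ?] /formE[? ? ?]; apply/formE; split.
- exact: wedge_homogeneous.
- exact: wedge_multilinear.
- exact: wedge_skew.
Qed.

Lemma form_one_form : is_form 0 (@form_one R V).
Proof.
have cat0 (s1 s2 : seq V) x : form_one (s1 ++ x :: s2) = 0.
  by rewrite /form_one size_cat /= addnS.
split=> [s|s1 s2 a x y|s1 s2 s3 x]; rewrite ?cat0 ?mulr0 ?addr0 //.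
by rewrite /form_one; case: eqP.
Qed.

Lemma wedge_prodS k (a : 'I_k.+1 -> ext_form V) :
  wedge_prod a = wedge (a ord0) (wedge_prod (fun j => a (lift ord0 j))).
Proof. by rewrite /wedge_prod big_ord_recl. Qed.

Lemma wedge_prod_form k d (a : 'I_k -> ext_form V) :
  (forall j, is_form d (a j)) -> is_form (k * d) (wedge_prod a).
Proof.
elim: k a => [|k IH] a ha; first by rewrite /wedge_prod big_ord0; exact: form_one_form.
by rewrite wedge_prodS mulSn; apply: wedge_form; [exact: ha|exact: IH].
Qed.

Lemma conj_form k w : is_form k w -> is_form k (form_conj w).
Proof.
case=> h1 h2 h3; split=> [s /h1 e|s1 s2 a x y|s1 s2 s3 x]; rewrite /form_conj.
- by rewrite e rmorph0.
- by rewrite h2 rmorphD rmorphM /= oppr0.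
- by rewrite h3 rmorph0.
Qed.

Lemma scale_form k c w : is_form k w -> is_form k (form_scale c w).
Proof.
case=> h1 h2 h3; split=> [s /h1 e|s1 s2 a x y|s1 s2 s3 x]; rewrite /form_scale.
- by rewrite e mulr0.
- by rewrite h2; ring.
- by rewrite h3 mulr0.
Qed.

Lemma wedge_prod_kill k (a : 'I_k -> ext_form V) x s :
  (forall j t, a j (x :: t) = 0) -> wedge_prod a (x :: s) = 0.
Proof.
elim: k a s => [|k IH] a s ha; first by rewrite /wedge_prod big_ord0.
rewrite wedge_prodS wedge_cons wedge0l ?add0r; last exact: ha.
by rewrite wedge0r // => t; apply: IH => j u; apply: ha.
Qed.

Lemma wedge_contractl_seq w1 w2 s1 s2 :
  (forall x t, x \in s1 -> w2 (x :: t) = 0) ->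
  wedge w1 w2 (s1 ++ s2) = wedge (fun t => w1 (s1 ++ t)) w2 s2.
Proof.
elim: s1 w1 => [|x s1 IH] w1 h //=; rewrite wedge_contractl.
  by rewrite IH // => y t ys; apply: h; rewrite inE ys orbT.
by move=> t; apply: h; rewrite mem_head.
Qed.

(** The only shuffle that contributes is the trivial one. *)
Lemma wedge_cat_eval w1 w2 s1 s2 : is_form (size s1) w1 ->
  (forall x t, x \in s1 -> w2 (x :: t) = 0) ->
  wedge w1 w2 (s1 ++ s2) = w1 s1 * w2 s2.
Proof.
move=> [h1 _ _] h2; rewrite wedge_contractl_seq //.
rewrite (@wedge_linl _ (@form_one R V) (fun=> 0) _ (w1 s1)).
  by rewrite wedge1l (@wedge0l (fun=> 0)) // addr0.
case=> [|y t]; first by rewrite cats0 /form_one mulr1 addr0.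
by rewrite /form_one mulr0 addr0 h1 // size_cat /=; lia.
Qed.

Lemma wedge11 (a c : ext_form V) x y : is_form 1 a -> is_form 1 c ->
  wedge a c [:: x; y] = a [:: x] * c [:: y] - a [:: y] * c [:: x].
Proof.
move=> [ha _ _] [hc _ _].
rewrite !wedge_cons !wedge_nil /signed /contract /=.
by rewrite (ha [:: x; y]) // (hc [:: x; y]) //; ring.
Qed.

End Exterior.

(** * Forms of top degree *)

Section TopForms.
Variables (R : realType) (V : vectType R).
Implicit Types (w : ext_form V) (s t : seq V) (x y v : V).

Lemma contract_form k x w : is_form k w -> is_form k.-1 (contract x w).
Proof.
move=> /formE[h1 h2 h3]; apply/formE; split.
- by move=> s hs; apply: h1 => /= e; apply: hs; rewrite -e.
- exact: contract_multilinear.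
- exact: contract_skew.
Qed.

Lemma multilinear0 w s1 s2 : multilinear w -> w (s1 ++ 0 :: s2) = 0.
Proof.
move=> h; have := h s1 s2 1 0 0; rewrite scaler0 addr0 mul1r => /eqP.
by rewrite -subr_eq0 opprD addrA subrr add0r oppr_eq0 => /eqP.
Qed.

Lemma multilinear_sum (I : Type) (r : seq I) (c : I -> R) (v : I -> V) w s1 s2 :
  multilinear w ->
  w (s1 ++ (\sum_(i <- r) c i *: v i) :: s2)
  = \sum_(i <- r) (c i)%:C * w (s1 ++ v i :: s2).
Proof.
move=> h; elim: r => [|i r IH]; first by rewrite !big_nil multilinear0.
by rewrite !big_cons h IH.
Qed.

Lemma form_mem0 k w x s : is_form k w -> x \in s -> w (x :: s) = 0.
Proof. by case=> _ _ h /splitPr[s1 s2]; apply: (h [::]). Qed.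

Lemma form_span0 k w x s : is_form k w -> x \in <<s>>%VS -> w (x :: s) = 0.
Proof.
move=> hw xs; have xE := coord_span (X := in_tuple s) xs.
have /formE[_ hm _] := hw; have := multilinear_sum (index_enum _)
  (fun i => coord (in_tuple s) i x) (fun i => s`_i) [::] s hm.
rewrite -xE /= => ->.
apply: big1 => i _.
by rewrite (form_mem0 hw) ?mulr0 ?mem_nth.
Qed.

Lemma form_free k w s : is_form k w -> w s != 0 -> free s.
Proof.
elim: s k w => [|x s IH] k w hw ws; first exact: nil_free.
rewrite free_cons (IH k.-1 (contract x w)) ?andbT //; last exact: contract_form.
by apply: contra ws => /(form_span0 hw) ->.
Qed.

(** The exchange step of Steinitz: since [x] is not in the span of [f], some
    vector [y] of [t] occurs in the expression of [x] with a nonzero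
    coefficient. *)
Lemma span_exchange (f t : seq V) x :
  x \notin <<f>>%VS -> x \in <<f ++ t>>%VS ->
  exists t1 y t2 (c : R) u,
    [/\ t = t1 ++ y :: t2, c != 0, u \in <<f ++ t1 ++ t2>>%VS & x = c *: y + u].
Proof.
move=> xf; elim: t => [|y t IH]; first by rewrite cats0 (negPf xf).
have [/IH[t1 [z [t2 [c [u [-> c0 uU ->]]]]]] _|xt] := boolP (x \in <<f ++ t>>%VS).
  exists (y :: t1), z, t2, c, u; split=> //.
  apply: subvP uU; apply: sub_span => v.
  by rewrite !(mem_cat, inE) => /or3P[]->; rewrite ?orbT.
rewrite span_cat span_cons addvA (addvC <<f>>%VS) -addvA -span_cat.
move=> /memv_addP[_ /vlineP[c ->] [u uU xE]].
exists [::], y, t, c, u; split=> //.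
by apply: contra xt => /eqP c0; rewrite xE c0 scale0r add0r.
Qed.

(** By induction on [f]: if [w (f ++ t) != 0], then [f ++ t] is a basis and the
    next vector [x] can replace one of the vectors of [t]; this multiplies the
    value of [w] by a nonzero scalar, so it cannot be zero. *)
Lemma top_form_eq0 w (f : seq V) :
  is_form (\dim {:V}) w -> free f -> (forall t, w (f ++ t) = 0) -> w =1 (fun=> 0).
Proof.
move=> hw; elim: f => [|x f IH] ff hf; first exact: hf.
move: ff; rewrite free_cons => /andP[xf ff].
apply: IH => // t; apply/eqP/negPn/negP => wt.
have fft := form_free hw wt; have /formE[hh hm hs] := hw.
have st : size (f ++ t) = \dim {:V}.
  by apply/eqP; apply: contra_neqT wt => /eqP/hh.
have full : <<f ++ t>>%VS = fullv.
  by apply/eqP; rewrite eqEdim subvf /= -st (eqP fft).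
have [|t1 [y [t2 [c [u [et c0 uU ex]]]]]] := @span_exchange f t x xf.
  by rewrite full memvf.
have := hf (t1 ++ t2); rewrite ex /= (hm [::]) /= (form_span0 hw uU) addr0.
move=> /eqP; rewrite mulf_eq0 (inj_eq (@complexI R)) (negPf c0) /= => /eqP wy.
by move: wt; rewrite et catA skew_rotate // -catA wy mulr0 eqxx.
Qed.

End TopForms.

(** * Forms of type (1,0) and complex subspaces *)

Section ComplexLinear.
Variables (R : realType) (V : vectType R) (J : 'End(V)).
Hypothesis JJ : forall x, J (J x) = - x.
Implicit Types (w : ext_form V) (s t : seq V) (x y v : V) (W : {vspace V}).

Definition Jstable W := forall x, x \in W -> J x \in W.

(** If [J y = a y + u] with [u] in [W], applying [J] again gives
    [(-1 - a^2) y] in [W], and this coefficient is negative. *)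
Lemma J_notin_line W y : Jstable W -> y \notin W -> J y \notin (<[y]> + W)%VS.
Proof.
move=> hW yW; apply/negP => /memv_addP[_ /vlineP[a ->] [u uW Jy]].
have e : (-1 - a ^+ 2) *: y = a *: u + J u.
  have h : - y = a *: (a *: y + u) + J u by rewrite -Jy -JJ {1}Jy linearP.
  by rewrite scalerBl scaleN1r h scalerDr scalerA -expr2 addrC -[_ + _ + J u]addrA addKr.
have n0 : -1 - a ^+ 2 != 0 by apply: ltr0_neq0; nra.
case/negP: yW; have -> : y = (-1 - a ^+ 2)^-1 *: (a *: u + J u).
  by rewrite -e scalerA mulVf // scale1r.
by rewrite memvZ // memvD ?memvZ ?hW.
Qed.

Lemma Jstable_line W y : Jstable W -> Jstable (<[y]> + <[J y]> + W)%VS.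
Proof.
move=> hW x /memv_addP[_ /memv_addP[_ /vlineP[a ->] [_ /vlineP[c ->] ->]] [u uW ->]].
rewrite !linearD !linearZ /= JJ memv_add ?hW // addrC.
by rewrite memv_add ?memvZ ?memvN ?memv_line.
Qed.

Lemma Jstable0 : Jstable 0%VS.
Proof. by move=> x; rewrite !memv0 => /eqP->; rewrite linear0. Qed.

Definition one_form (l : V -> R[i]) : ext_form V :=
  fun s => if s is [:: v] then l v else 0.

Lemma one_formP (l : V -> R[i]) :
  (forall (a : R) x y, l (a *: x + y) = a%:C * l x + l y) -> is_form 1 (one_form l).
Proof.
move=> hl; split=> [|s1 s2 a x y|].
- by move=> [|x [|y s]].
- case: s1 => [|z [|z' s1]]; case: s2 => [|z2 s2] //=; rewrite ?mulr0 ?addr0 //.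
- by move=> [|z [|z' s1]] [|z2 s2] s3 x.
Qed.

(** From a real functional [l] with the required property one gets the complex
    linear functional with real part [l], namely [l v - i l (J v)]. *)
Lemma separating_form10 W x : Jstable W -> x \notin W ->
  exists2 mu, form10 J mu & mu [:: x] != 0 /\ forall v t, v \in W -> mu (v :: t) = 0.
Proof.
move=> hW xW; pose p v := v - projv W v.
have pD (a : R) u v : p (a *: u + v) = a *: p u + p v.
  by rewrite /p linearP scalerBr; rewrite opprD addrACA.
have pW v : v \in W -> p v = 0 by move=> /projv_id e; rewrite /p e subrr.
have [i li] : exists i, coord (vbasis fullv) i (p x) != 0.
  apply/existsP; apply: contraR xW => /existsPn h.
  suff /eqP : p x = 0 by rewrite subr_eq0 => /eqP->; apply: memv_proj.
  rewrite (coord_vbasis (memvf (p x))) big1 // => i _.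
  by have := h i; rewrite negbK => /eqP->; rewrite scale0r.
pose l v := coord (vbasis fullv) i (p v).
have lD (a : R) u v : l (a *: u + v) = a * l u + l v by rewrite /l pD linearP.
pose m v : R[i] := (l v)%:C - 'i * (l (J v))%:C.
have l0 v : v \in W -> l v = 0 by move=> /pW e; rewrite /l e linear0.
exists (one_form m).
  split=> [|v]; first apply: one_formP => a u v.
    by rewrite /m linearP !lD !rmorphD !rmorphM /=; ring.
  have lN : l (- v) = - l v.
    rewrite -[- v]addr0 -[- v]scaleN1r lD mulN1r (l0 0) ?addr0 ?mem0v //.
  rewrite /one_form /= /m JJ lN rmorphN /= mulrBr mulrA -expr2 sqr_i; ring.
split=> [/=|v [|? ?] vW //=].
  rewrite /m eq_complex /= !mul0r !mul1r subr0 oppr0 addr0.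
  by rewrite negb_and li.
by rewrite /m !l0 ?hW // rmorph0 mulr0 subr0.
Qed.

(** The factors are found one at a time: [mu 0] kills [W] but not [x], and the
    others kill [W] and the complex line of [x].  Then evaluating the product
    on [x] followed by the vectors found for the other factors leaves a
    single nonzero term. *)
Lemma annihilating_simple_form W k : Jstable W -> (\dim W + 2 * k <= \dim {:V})%N ->
  exists mu : 'I_k -> ext_form V,
    [/\ forall j, form10 J (mu j),
        forall j v t, v \in W -> mu j (v :: t) = 0 &
        nonzero_form (wedge_prod mu)].
Proof.
elim: k W => [|k IH] W hW hd.
  exists (fun j => one_form (fun=> 0)); split; try by case.
  by exists [::]; rewrite /wedge_prod big_ord0 /form_one oner_eq0.
have [x xW] : exists x, x \notin W.
  have /existsNP[x /negP xW] : ~ (forall x, x \in W).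
    move=> h; suff : (\dim {:V} <= \dim W)%N by lia.
    by apply: dimvS; apply/subvP => v _; apply: h.
  by exists x.
have [m0 m10 [m0x m0W]] := separating_form10 hW xW.
have [|mu [mu10 muW [s mus]]] := IH _ (@Jstable_line W x hW).
  apply: leq_trans hd; rewrite mulnS addnA leq_add2r.
  have h1 := dimv_add_leqif (<[x]> + <[J x]>) W.
  have h2 := dimv_add_leqif <[x]> <[J x]>.
  have h3 := dim_vline x; have h4 := dim_vline (J x).
  have := leq_b1 (x != 0); have := leq_b1 (J x != 0).
  by move: h1 h2 => [h1 _] [h2 _]; rewrite h3 h4 in h2; lia.
exists (fun j => oapp mu m0 (unlift ord0 j)); split.
- by move=> j; case: unliftP => [i|] _ /=.
- move=> j v t vW; case: unliftP => [i|] _ /=; last exact: m0W.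
  by apply: muW; rewrite -[v]add0r memv_add ?mem0v.
exists ([:: x] ++ s); rewrite wedge_prodS wedge_cat_eval.
- have -> : wedge_prod (fun j => oapp mu m0 (unlift ord0 (lift ord0 j)))
      = wedge_prod mu by congr wedge_prod; apply/funext => j; rewrite liftK.
  by rewrite unlift_none mulf_neq0.
- by rewrite unlift_none; case: m10.
move=> y t; rewrite inE => /eqP->; apply: wedge_prod_kill => j u.
rewrite liftK /=; apply: muW.
by do 2!apply: (subvP (addvSl _ _)); exact: memv_line.
Qed.

End ComplexLinear.

(** * Forms of type (k,k), volume forms and transversality *)

Section ComplexForms.
Variables (R : realType) (V : vectType R).
Implicit Types (w : ext_form V) (s t : seq V) (x y v : V).

Variables (J : 'End(V)).

(** Stated for pairs of forms, because contracting [w1'] with [J x] and [w1]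
    with [x] gives different forms that are related in the same way. *)
Lemma wedge_J w1 w2 w1' w2' (c1 c2 : R[i]) s :
  (forall t, w1' (map J t) = c1 * w1 t) ->
  (forall t, w2' (map J t) = c2 * w2 t) ->
  wedge w1' w2' (map J s) = c1 * c2 * wedge w1 w2 s.
Proof.
elim: s w1 w2 w1' w2' => [|x s IH] w1 w2 w1' w2' h1 h2.
  by rewrite /= !wedge_nil -[[::]]/(map J [::]) h1 h2 /=; ring.
rewrite /= !wedge_cons mulrDr; congr (_ + _); apply: IH => // t.
- by rewrite -[RHS]h1.
- by rewrite /signed size_map h1; ring.
- by rewrite -[RHS]h2.
Qed.

Lemma wedge_prod_J k (a : 'I_k -> ext_form V) (c : R[i]) s :
  (forall j t, a j (map J t) = c * a j t) ->
  wedge_prod a (map J s) = c ^+ k * wedge_prod a s.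
Proof.
elim: k a s => [|k IH] a s h.
  by rewrite /wedge_prod !big_ord0 /form_one size_map expr0 mul1r.
rewrite !wedge_prodS exprS; apply: wedge_J => t; first exact: h.
by apply: IH => j u; apply: h.
Qed.

Lemma form10_J a s : form10 J a -> a (map J s) = 'i * a s.
Proof.
by move=> [[h _ _] hJ]; case: s => [|x [|y s]] //=; rewrite !h ?mulr0.
Qed.

(** Each of the [k] factors of type (1,0) contributes [i], and each of the [k]
    conjugate factors contributes [- i]. *)
Lemma pq_form_J k w s : pq_form J k k w -> w (map J s) = w s.
Proof.
move=> [N [c [a [e [ha he hw]]]]]; rewrite !hw; apply: eq_bigr => r _.
rewrite (@wedge_J (wedge_prod (a r)) (wedge_prod (fun j => form_conj (e r j)))
  _ _ ('i ^+ k) ((- 'i) ^+ k)).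
- rewrite -exprMn mulrN -expr2 sqr_i opprK expr1n; ring.
- by move=> t; apply: wedge_prod_J => j u; apply: form10_J.
- move=> t; apply: wedge_prod_J => j u; rewrite /form_conj form10_J // rmorphM /=.
  by congr (_ * _); apply/eqP; rewrite eq_complex /= oppr0 !eqxx.
Qed.

Lemma pq_form_form p q w : pq_form J p q w -> is_form (p + q) w.
Proof.
move=> [N [c [a [e [ha he hw]]]]].
have hf r : is_form (p + q)
    (wedge (wedge_prod (a r)) (wedge_prod (fun j => form_conj (e r j)))).
  apply: wedge_form; rewrite -[X in is_form X]muln1; apply: wedge_prod_form => j.
    by case: (ha r j).
  by apply: conj_form; case: (he r j).
split=> [s hs|s1 s2 b x y|s1 s2 s3 x]; rewrite !hw.
- by apply: big1 => r _; case: (hf r) => -> //; rewrite mulr0.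
- rewrite big_distrr -big_split /=; apply: eq_bigr => r _.
  by case: (hf r) => _ -> _; ring.
- by apply: big1 => r _; case: (hf r) => _ _ ->; rewrite mulr0.
Qed.

(** Uniqueness of the coordinates says that the [n] functionals are independent
    over the complex numbers, so the matrix of their values on a real basis of
    [V] has a right inverse [B]; a complex combination of vectors is made real
    by letting [J] act as [i]. *)
Lemma dual_vectors n (a : 'I_n -> ext_form V) : form10_basis J a ->
  exists e : 'I_n -> V, forall i j, a i [:: e j] = (i == j)%:R.
Proof.
move=> [ha hu]; pose v := vbasis {:V}.
have aS i (r : 'I_(\dim {:V}) -> R) (y : 'I_(\dim {:V}) -> V) :
    a i [:: \sum_k r k *: y k] = \sum_k (r k)%:C * a i [:: y k].
  have [fa _] := ha i; have /formE[_ hm _] := fa.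
  exact: (multilinear_sum _ _ _ [::] [::] hm).
have aD i x y : a i [:: x + y] = a i [:: x] + a i [:: y].
  have [[_ hm _] _] := ha i.
  by have := hm [::] [::] 1 x y; rewrite scale1r mul1r.
pose A : 'M[R[i]]_(n, \dim {:V}) := \matrix_(i, k) a i [:: v`_k].
have : row_free A.
  apply/inj_row_free => c cA.
  have z0 : form10 J (fun=> 0).
    split=> [|x]; last by rewrite mulr0.
    by split=> [//|? ? ? ? ?|//]; rewrite mulr0 addr0.
  have [d [_ dU]] := hu _ z0; rewrite -(dU c); last first.
    move=> s; case: s => [|x [|y s]].
    - by rewrite big1 // => i _; have [[-> //]] := ha i; rewrite mulr0.
    - rewrite (coord_vbasis (memvf x)).
      under eq_bigr do rewrite aS big_distrr /=.
      rewrite exchange_big big1 //= => k _.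
      have := congr1 (fun M : 'rV_(\dim {:V}) => M 0 k) cA; rewrite !mxE => e.
      transitivity ((coord (vbasis {:V}) k x)%:C * \sum_i c 0 i * A i k).
        by rewrite big_distrr; apply: eq_bigr => i _; rewrite mxE /=; ring.
      by rewrite e mulr0.
    - by rewrite big1 // => i _; have [[-> //]] := ha i; rewrite mulr0.
  by apply: dU => s; rewrite big1 // => i _; rewrite mxE mul0r.
move=> /row_freeP[B AB].
exists (fun j => \sum_k (complex.Re (B k j) : R) *: (v`_k : V)
  + \sum_k (complex.Im (B k j) : R) *: J v`_k) => i j.
rewrite aD !aS -big_split /=.
have := congr1 (fun M : 'M_n => M i j) AB; rewrite !mxE => <-.
apply: eq_bigr => k _; rewrite mxE; have [_ ->] := ha i.
by rewrite [B k j in RHS]complexE complexiE; ring.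
Qed.

(** Evaluate on [e_1, J e_1, ..., e_n, J e_n] for the dual vectors [e_j]: each
    factor contributes 2. *)
Lemma volume_form_neq0 n nu : volume_form J n nu -> nonzero_form nu.
Proof.
move=> [c [a [c0 /[dup] ab /dual_vectors[e ae] hn]]].
have ha j : form10 J (a j) by case: ab.
suff [s hs] : nonzero_form
    (wedge_prod (fun j => form_scale 'i (wedge (a j) (form_conj (a j))))).
  exists s; rewrite hn /form_scale mulf_neq0 //.
  by rewrite (inj_eq (@complexI R)) gt_eqF.
elim: n a e ae ha {ab nu hn} => [|n IH] a e ae ha.
  by exists [::]; rewrite /wedge_prod big_ord0 /form_one oner_eq0.
have [|j|s hs] := IH (fun j => a (lift ord0 j)) (fun j => e (lift ord0 j)).
- by move=> i j; rewrite ae (inj_eq lift_inj).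
- exact: ha.
have aJ i x : a i [:: J x] = 'i * a i [:: x] by case: (ha i).
have fa i : is_form 1 (a i) by case: (ha i).
exists ([:: e ord0; J (e ord0)] ++ s); rewrite wedge_prodS wedge_cat_eval.
- rewrite mulf_neq0 // /form_scale wedge11 //; last exact: conj_form.
  rewrite /form_conj aJ ae eqxx mulr1 mul1r rmorph1 mulr1.
  by rewrite eq_complex /=; apply/nandP; left; lra.
- exact/scale_form/(@wedge_form _ _ 1 1)/conj_form.
move=> x t xe; apply: wedge_prod_kill => j u; rewrite /form_scale.
have ax (v : seq V) : a (lift ord0 j) (x :: v) = 0.
  case: v => [|y v]; last by have [-> //] := fa (lift ord0 j).
  by move: xe; rewrite !inE => /orP[]/eqP->; rewrite ?aJ ae /= ?mulr0.
rewrite wedge_cons wedge0l // wedge0r ?addr0 ?mulr0 // => v.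
by rewrite /contract /form_conj ax rmorph0.
Qed.

Hypothesis JJ : forall x, J (J x) = - x.

(** Apply transversality to a simple form [psi] that vanishes on the complex
    plane [W] spanned by [X] and [Y].  On lists that start with the four given
    vectors, all of them must go to [Om]. *)
Lemma transverse_neq0 n Om X Y : (2 <= n)%N -> \dim {:V} = (2 * n)%N ->
  is_form 4 Om -> transverse J n 2 Om ->
  free [:: X; J X; Y; J Y] -> Om [:: X; J X; Y; J Y] != 0.
Proof.
move=> n2 hd hO hT hF; apply/eqP => O0.
pose W := (<[Y]> + <[J Y]> + (<[X]> + <[J X]> + 0))%VS.
have WJ : Jstable J W by do 2!apply: Jstable_line => //; apply: Jstable0.
have FW x : x \in [:: X; J X; Y; J Y] -> x \in W.
  rewrite /W addv0 !inE => /or4P[]/eqP->.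
  - by apply: (subvP (addvSr _ _)); apply: (subvP (addvSl _ _)); apply: memv_line.
  - by apply: (subvP (addvSr _ _)); apply: (subvP (addvSr _ _)); apply: memv_line.
  - by apply: (subvP (addvSl _ _)); apply: (subvP (addvSl _ _)); apply: memv_line.
  - by apply: (subvP (addvSl _ _)); apply: (subvP (addvSr _ _)); apply: memv_line.
have [|mu [mu10 muW mu0]] := @annihilating_simple_form _ _ _ JJ W (n - 2) WJ.
  rewrite hd; suff : (\dim W <= 4)%N by lia.
  have -> : W = <<[:: Y; J Y; X; J X]>>%VS.
    by rewrite /W !span_cons span_nil !addvA.
  exact: dim_span.
have /hT : simple_form J (n - 2) (wedge_prod mu) by exists mu.
move=> /(_ mu0) /volume_form_neq0 [s].
have fmu : is_form (n - 2) (wedge_prod mu).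
  by rewrite -[X in is_form X]muln1; apply: wedge_prod_form => j; case: (mu10 j).
have psiW x t : x \in [:: X; J X; Y; J Y] -> wedge_prod mu (x :: t) = 0.
  by move=> /FW xW; apply: wedge_prod_kill => j u; apply: muW.
rewrite /form_scale (@top_form_eq0 _ _ _ [:: X; J X; Y; J Y]) ?mulr0 ?eqxx //.
  have -> : \dim {:V} = (4 + (n - 2) + (n - 2))%N by lia.
  by do ?apply: wedge_form => //; apply: conj_form.
move=> t; rewrite wedge_contractl_seq; last first.
  by move=> x u xF; rewrite /form_conj psiW // rmorph0.
by rewrite wedge0l // => u; rewrite wedge_cat_eval // O0 mul0r.
Qed.

End ComplexForms.

(** * Brackets of nilpotent Lie algebras *)

(** Brackets and 2-forms are linear in each argument separately; these facts
    apply to the partial maps without packaging them as morphisms. *)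
Section LinearFacts.
Variables (R : realType) (V : vectType R) (U : lmodType R) (f : V -> U).
Hypothesis hf : forall a x y, f (a *: x + y) = a *: f x + f y.

Lemma lin0 : f 0 = 0.
Proof.
have /eqP := hf 1 0 0; rewrite !scale1r addr0 -subr_eq0 opprD addrA subrr add0r.
by rewrite oppr_eq0 => /eqP.
Qed.

Lemma linD x y : f (x + y) = f x + f y.
Proof. by rewrite -[x]scale1r hf !scale1r. Qed.

Lemma linZ a x : f (a *: x) = a *: f x.
Proof. by rewrite -[a *: x]addr0 hf lin0 addr0. Qed.

Lemma linN x : f (- x) = - f x.
Proof. by rewrite -[- x]scaleN1r linZ scaleN1r. Qed.

Lemma linB x y : f (x - y) = f x - f y.
Proof. by rewrite linD linN. Qed.

Lemma lin_sum (I : Type) (r : seq I) (v : I -> V) :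
  f (\sum_(i <- r) v i) = \sum_(i <- r) f (v i).
Proof. by apply: big_morph; [exact: linD|exact: lin0]. Qed.

Lemma lin_span0 (s : seq V) x :
  (forall v, v \in s -> f v = 0) -> x \in <<s>>%VS -> f x = 0.
Proof.
move=> h xs; rewrite (coord_span (X := in_tuple s) xs) lin_sum big1 // => i _.
by rewrite linZ h ?scaler0 // mem_nth.
Qed.

End LinearFacts.

Section Nilpotent.
Variables (R : realType) (V : vectType R) (b : lie_bracket V).

Lemma bracketC x y : b x y = - b y x.
Proof.
have hl z := fun a u v => @bracket_linearl R V b a u v z.
have hr x := fun a u v => @bracket_linearr R V b a x u v.
have := bracket_alt b (x + y).
rewrite (linD (hl _)) !(linD (hr _)) !bracket_alt add0r addr0.
by move/eqP; rewrite addr_eq0 => /eqP.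
Qed.

Lemma bracket_lower_central k x y :
  y \in lower_central b k -> b x y \in lower_central b k.+1.
Proof.
have hl z := fun a u v => @bracket_linearl R V b a u v z.
have hr x := fun a u v => @bracket_linearr R V b a x u v.
move=> yk; rewrite (coord_vbasis (memvf x)) (coord_vbasis yk) /=.
rewrite (lin_sum (hl _)) memv_suml // => i _; rewrite (linZ (hl _)) memvZ //.
rewrite (lin_sum (hr _)) memv_suml // => j _; rewrite (linZ (hr _)) memvZ //.
by apply/memv_span/allpairs_f; apply: mem_nth; rewrite size_tuple.
Qed.

Lemma bracket_lower_central1 x y : b x y \in lower_central b 1.
Proof. by apply: bracket_lower_central; apply: memvf. Qed.

Lemma lower_centralS k : (lower_central b k.+1 <= lower_central b k)%VS.
Proof.
elim: k => [|k IH]; first exact: subvf.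
apply/span_subvP => _ /allpairsP[[x y] [_ /vbasis_mem yk ->]].
exact/bracket_lower_central/(subvP IH).
Qed.

(** Take [v] in the last term of the descending central series, from the
    [k]-th one on, that is not contained in [W]. *)
Lemma central_mod (k : nat) (W : {vspace V}) : nilpotent_lie b ->
  ~~ (lower_central b k <= W)%VS ->
  exists v, [/\ v \in lower_central b k, v \notin W & forall x, b x v \in W].
Proof.
move=> [K hK] hkW.
have exj : exists j, (lower_central b (k + j) <= W)%VS.
  exists K; suff -> : lower_central b (k + K) = 0%VS by exact: sub0v.
  apply/eqP; rewrite -subv0 -hK; elim: (k) => [|k' IH]; first exact: subvv.
  exact: subv_trans (lower_centralS _) IH.
case: (ex_minnP exj) => [[|j]]; first by rewrite addn0 (negPf hkW).
rewrite addnS => hj hmin.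
have /subvPn[v vk vW] : ~~ (lower_central b (k + j) <= W)%VS.
  by apply/negP => /hmin; rewrite ltnn.
exists v; split=> // [|x]; last by apply: (subvP hj); apply: bracket_lower_central.
apply: subvP vk; elim: (j) => [|j' IH]; first by rewrite addn0.
by rewrite addnS; apply: subv_trans (lower_centralS _) IH.
Qed.

End Nilpotent.

(** * Kähler forms on nilpotent Lie algebras *)

(** A closed [J]-invariant 2-form [om] on the quotient by a central [J]-stable
    ideal [I], seen as a form on the Lie algebra whose radical contains [I].
    This avoids quotients: congruences modulo [I] replace equalities in the
    quotient, and both the bracket and [om] are insensitive to them.  The
    symmetric form [g] below is the Kähler metric. *)
Section Kahler.
Variables (R : realType) (V : vectType R) (b : lie_bracket V).
Variables (J : complex_structure b) (I : {vspace V}) (om : V -> V -> R).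
Hypothesis nil : nilpotent_lie b.
Hypothesis Icentral : forall x y, x \in I -> b x y = 0.
Hypothesis IJ : forall x, x \in I -> J x \in I.
Hypothesis om_lin : forall (a : R) x y z, om (a *: x + y) z = a * om x z + om y z.
Hypothesis omC : forall x y, om x y = - om y x.
Hypothesis omJ : forall x y, om (J x) (J y) = om x y.
Hypothesis omI : forall x y, x \in I -> om x y = 0.
Hypothesis om_closed :
  forall x y z, om (b x y) z + om (b y z) x + om (b z x) y = 0.

Let br z := fun a x y => @bracket_linearr R V b a z x y.

Let oml z : forall (a : R) x y, (om (a *: x + y) z : R^o) = a *: (om x z : R^o) + om y z.
Proof. by move=> a x y; rewrite om_lin. Qed.
Let omr z : forall (a : R) x y, (om z (a *: x + y) : R^o) = a *: (om z x : R^o) + om z y.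
Proof.
move=> a x y; change (om z (a *: x + y) = a * om z x + om z y).
by rewrite omC om_lin (omC z x) (omC z y); ring.
Qed.

Let omIr x y : y \in I -> om x y = 0.
Proof. by move=> /omI h; rewrite omC h oppr0. Qed.

Let bI x y : y \in I -> b x y = 0.
Proof. by move=> /Icentral h; rewrite bracketC h oppr0. Qed.

Let om_eql x x' y : x - x' \in I -> om x y = om x' y.
Proof.
by move=> /omI h; apply/eqP; rewrite -subr_eq0 -(linB (oml y)) h.
Qed.

Let om_eqr x y y' : y - y' \in I -> om x y = om x y'.
Proof.
by move=> /omIr h; apply/eqP; rewrite -subr_eq0 -(linB (omr x)) h.
Qed.

Let b_eqr x y y' : y - y' \in I -> b x y = b x y'.
Proof. by move=> /bI h; apply/eqP; rewrite -subr_eq0 -(linB (br x)) h. Qed.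

Let g x y := om x (J y).

Let gl z : forall (a : R) x y, (g (a *: x + y) z : R^o) = a *: (g x z : R^o) + g y z.
Proof. by move=> a x y; rewrite /g oml. Qed.

Let gC x y : g x y = g y x.
Proof. by rewrite /g -omJ (cplx_sq J) (linN (omr _)) omC; apply: opprK. Qed.

Let gr z : forall (a : R) x y, (g z (a *: x + y) : R^o) = a *: (g z x : R^o) + g z y.
Proof. by move=> a x y; rewrite !(gC z) gl. Qed.

Let gIl x y : x \in I -> g x y = 0.
Proof. exact: omI. Qed.

Let gIr x y : y \in I -> g x y = 0.
Proof. by rewrite gC; exact: omI. Qed.

Let gJ x y : g (J x) (J y) = g x y.
Proof. by rewrite /g omJ. Qed.

Let g_eqr x y y' : y - y' \in I -> g x y = g x y'.
Proof. by rewrite !(gC x); exact: om_eql. Qed.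

Let gJl x y : g (J x) y = - g x (J y).
Proof. by rewrite -gJ (cplx_sq J) (linN (gl _)). Qed.

Hypothesis gpos : forall x, x \notin I -> 0 < g x x.

(** Modulo [I], [e] is an orthonormal basis of an ideal, and every [ad x] is
    strictly triangular in it.  Orthonormality appears as the Parseval expansion,
    which is how it is used; of the triangularity, only the vanishing of the
    diagonal entries of [ad x] and [ad x ad y] is recorded. *)
Definition frame (e : seq V) : Prop :=
  [/\ forall x, x \in (<<e>> + I)%VS -> x - \sum_(v <- e) g x v *: v \in I,
      forall x y, y \in (<<e>> + I)%VS -> b x y \in (<<e>> + I)%VS &
      forall v, v \in e ->
        forall x y, g (b x v) v = 0 /\ g (b x (b y v)) v = 0].

Lemma frame_nil : frame [::].
Proof.
split=> [x|x y|//]; rewrite span_nil add0v; first by rewrite big_nil subr0.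
by move=> /bI->; rewrite mem0v.
Qed.

(** By nilpotency there is [v] outside the ideal [W] spanned so far with all
    its brackets in [W].  Subtracting the orthogonal projection on [W] and
    normalising keeps this property, so the new diagonal entries are scalar
    products of a vector of [W] with a vector orthogonal to [W]. *)
Lemma frame_cons e : frame e -> (<<e>> + I)%VS != fullv ->
  exists u, u \notin (<<e>> + I)%VS /\ frame (u :: e).
Proof.
set W := (<<e>> + I)%VS => -[hE hW hF] Wn.
have IW x : x \in I -> x \in W by move=> xI; apply: (subvP (addvSr _ _)).
have eW x : x \in e -> x \in W.
  by move=> xe; apply: (subvP (addvSl _ _)); apply: memv_span.
have [|v [_ vW bvW]] := @central_mod _ _ b 0 W nil.
  by apply: contra Wn => h; rewrite eqEsubv subvf.
pose u0 := v - \sum_(w <- e) g v w *: w.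
have sW x : \sum_(w <- e) g x w *: w \in W.
  by rewrite big_seq memv_suml // => w we; rewrite memvZ // eW.
have u0W : u0 \notin W.
  apply: contra vW => h.
  by rewrite -(subrK (\sum_(w <- e) g v w *: w) v) memvD.
have gu0 w : w \in W -> g u0 w = 0.
  move=> wW; rewrite (linB (gl _)) (lin_sum (gl _)).
  have -> : \sum_(i <- e) (g (g v i *: i) w : R^o) = g v (\sum_(i <- e) g w i *: i).
    rewrite (lin_sum (gr _)); apply: eq_bigr => i _.
    by rewrite (linZ (gl _)) (linZ (gr _)) (gC w); apply: mulrC.
  by rewrite -(linB (gr _)) gIr // hE.
have u0p : 0 < g u0 u0 by apply: gpos; apply: contra u0W; apply: IW.
pose c := (Num.sqrt (g u0 u0))^-1; pose u := c *: u0.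
have c0 : c != 0 by rewrite invr_eq0 gt_eqF // sqrtr_gt0.
have gu w : w \in W -> g u w = 0.
  by move=> /gu0 h; rewrite (linZ (gl _)) h; apply: mulr0.
have guu : g u u = 1.
  rewrite (linZ (gl _)) (linZ (gr _)) -[LHS]/(c * (c * g u0 u0)) mulrA -expr2.
  by rewrite exprVn sqr_sqrtr ?ltW // mulVf // gt_eqF.
have uW : u \notin W.
  apply: contra u0W => h; have -> : u0 = c^-1 *: u.
    by rewrite /u scalerA mulVf // scale1r.
  exact: memvZ.
have buW x : b x u \in W.
  rewrite (linZ (br _)) memvZ // (linB (br _)) memvB //.
  rewrite (lin_sum (br _)) big_seq memv_suml // => w we.
  by rewrite (linZ (br _)) memvZ // hW // eW.
have We : (<<u :: e>> + I = <[u]> + W)%VS by rewrite span_cons addvA.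
exists u; split=> //; split; rewrite ?We.
- move=> _ /memv_addP[_ /vlineP[k ->] [w wW ->]]; rewrite big_cons.
  have -> : g (k *: u + w) u = k.
    by rewrite gl guu (gC w) gu // addr0; apply: mulr1.
  have -> : \sum_(j <- e) g (k *: u + w) j *: j = \sum_(j <- e) g w j *: j.
    rewrite !big_seq; apply: eq_bigr => j je; congr (_ *: _).
    by rewrite gl gu ?eW // scaler0 add0r.
  by rewrite opprD addrACA subrr add0r hE.
- move=> x _ /memv_addP[_ /vlineP[k ->] [w wW ->]].
  apply: (subvP (addvSr _ _)).
  by rewrite br memvD ?(hW _ _ wW) ?memvZ ?buW.
- move=> w; rewrite inE => /predU1P[->|/hF//] x y.
  by split; rewrite gC gu //; apply: hW; apply: buW.
Qed.

Lemma full_frame : exists2 e, frame e & (<<e>> + I)%VS = fullv.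
Proof.
suff H k e : frame e -> (\dim {:V} - \dim (<<e>> + I) <= k)%N ->
    exists2 e, frame e & (<<e>> + I)%VS = fullv.
  exact: H frame_nil (leqnn _).
elim: k e => [|k IH] e he hk.
  by exists e => //; apply/eqP; rewrite eqEdim subvf /= -subn_eq0 -leqn0.
have [E|/(frame_cons he)[u [uW hu]]] := eqVneq (<<e>> + I)%VS fullv; first by exists e.
apply: IH hu _; rewrite span_cons -addvA.
have : (\dim (<<e>> + I) < \dim (<[u]> + (<<e>> + I)))%N.
  rewrite ltn_neqAle dimvS ?addvSr // andbT.
  rewrite (eq_leqif (dimv_leqif_eq (addvSr _ _))).
  by apply: contra uW => /eqP->; rewrite memvE addvSl.
by lia.
Qed.

(** Let [z] be central modulo [I] and [D = ad (J z)].  Closedness gives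
    [g [x, y] z = - om (D x) y - om x (D y)], so that the derivation identity
    for [D] on [H], the sum of the [[v, J v]], reduces to the vanishing of the
    sum of the [g (D v) (D v)]; by positivity [D] is zero modulo [I]. *)
Lemma definite_kahler_nilpotent x y : b x y \in I.
Proof.
have [e [hE _ hF] full] := full_frame.
have Jl (a : R) u v : J (a *: u + v) = a *: J u + J v by rewrite linearP.
have exp w : w - \sum_(v <- e) g w v *: v \in I by apply: hE; rewrite full memvf.
(* The trace of T may be computed in the orthonormal basis (J e_i). *)
have tr0 (T : V -> V) : (forall a x y, T (a *: x + y) = a *: T x + T y) ->
    (forall x, x \in I -> T x = 0) ->
    \sum_(v <- e) g (T (J v)) (J v) = \sum_(v <- e) g (T v) v.
  move=> hT TI.
  transitivity (\sum_(v <- e) \sum_(w <- e) g (J v) w * g (T (J v)) w).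
    apply: eq_bigr => v _; rewrite (g_eqr _ (exp (J v))) (lin_sum (gr _)).
    by apply: eq_bigr => w _; rewrite (linZ (gr _)).
  rewrite exchange_big; apply: eq_bigr => w _ /=.
  transitivity (g (T (\sum_(v <- e) g (J v) w *: J v)) w).
    rewrite (lin_sum hT) (lin_sum (gl _)); apply: eq_bigr => v _.
    by rewrite (linZ hT) (linZ (gl _)).
  congr g; apply/eqP; rewrite -subr_eq0 -(linB hT); apply/eqP/TI.
  have -> : \sum_(v <- e) g (J v) w *: J v = - J (\sum_(v <- e) g (J w) v *: v).
    rewrite linear_sum -sumrN; apply: eq_bigr => v _.
    by rewrite linearZ /= gJl gC scaleNr.
  have -> : - J (\sum_(v <- e) g (J w) v *: v) - w
      = J (J w - \sum_(v <- e) g (J w) v *: v).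
    by rewrite (linB Jl) (cplx_sq J) addrC.
  exact: IJ.
have ad0 u : \sum_(v <- e) g (b u v) v = 0.
  by rewrite big_seq big1 // => v /hF h; case: (h u u).
pose H := \sum_(v <- e) b v (J v).
(* Closedness at (v, J v, J u) turns om H (J u) into two traces of ad (J u). *)
have omH u : om H (J u) = 0.
  rewrite (lin_sum (oml _)).
  have E v : om (b v (J v)) (J u) = - g (b (J u) (J v)) (J v) - g (b (J u) v) v.
    have := om_closed v (J v) (J u); rewrite (bracketC b (J v)) (linN (oml _)).
    rewrite /g (cplx_sq J) (linN (omr _)) => h.
    by apply/eqP; rewrite -subr_eq0 -h; apply/eqP; rewrite !opprD !opprK; ring.
  under eq_bigr do rewrite E.
  rewrite big_split /= !sumrN (tr0 (b (J u))) ?ad0 ?oppr0 ?addr0 //.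
  by move=> ?; exact: bI.
have HI : H \in I.
  by apply/negPn/negP => /gpos; rewrite /g omH ltxx.
suff h : (lower_central b 1 <= I)%VS.
  by apply: (subvP h); apply: bracket_lower_central1.
apply/negPn/negP => /(central_mod nil)[z [z1 zI bzI]].
have bzl x1 : b z x1 \in I by rewrite bracketC memvN.
pose D := b (J z).
(* The Nijenhuis tensor at (z, x1), when z is central modulo I. *)
have DJ x1 : D (J x1) - J (D x1) \in I.
  have := cplx_integrable J z x1; rewrite /nijenhuis => /eqP.
  rewrite -addrA -addrA addrA addr_eq0 -/D => /eqP ->.
  by rewrite opprD !opprK memvD ?IJ.
have gbz x1 y1 : g (b x1 y1) z = - om (D x1) y1 - om x1 (D y1).
  have := om_closed x1 y1 (J z); rewrite -/(D _) (bracketC b y1) -/(D _).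
  rewrite (linN (oml _)) (omC (D y1)) => h.
  by apply/eqP; rewrite -subr_eq0 -h /g; apply/eqP; ring.
have DD x1 y1 : D (b x1 y1) = b (D x1) y1 + b x1 (D y1).
  have := bracket_jacobi b (J z) x1 y1.
  rewrite -/D (bracketC b y1) -/D (bracketC b y1) (linN (br _)) => /eqP.
  by rewrite -addrA -opprD subr_eq0 addrC => /eqP.
(* The derivation identity for D on [v, J v], summed over v and paired with z:
   the terms in D (D v) have trace zero, those in g (D v) (D v) add up. *)
have key : \sum_(v <- e) g (D v) (D v) = 0.
  have : g (D H) z = 0 by rewrite /D bI // (lin0 (gl _)).
  rewrite /D (lin_sum (br _)) (lin_sum (gl _)) -/D.
  have E v : v \in e -> g (D (b v (J v))) z = - (g (D v) (D v) *+ 2).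
    move=> /hF hv; rewrite DD (linD (gl _)).
    rewrite !gbz.
    have h1 : om (D (D v)) (J v) = 0 by have [_] := hv (J z) (J z).
    have h2 : om (D v) (D (J v)) = g (D v) (D v) by apply: om_eqr.
    have h3 : om v (D (D (J v))) = 0.
      rewrite /D (b_eqr _ (DJ v)) -/D (om_eqr _ (DJ (D v))).
      by rewrite -/(g _ _) gC.
    by rewrite h1 h2 h3 mulr2n; ring.
  rewrite big_seq; under eq_bigr do rewrite E //.
  rewrite -big_seq sumrN sumrMnl => /eqP.
  by rewrite oppr_eq0 mulrn_eq0 /= => /eqP.
have gge0 x1 : 0 <= g x1 x1.
  by have [xI|/gpos/ltW//] := boolP (x1 \in I); rewrite gIl.
have De v : v \in e -> D v \in I.
  move=> ve; apply/negPn/negP => /gpos; rewrite lt_neqAle => /andP[+ _].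
  move: key => /eqP; rewrite psumr_eq0 // => /allP /(_ v ve) /= /eqP ->.
  by rewrite eqxx.
have DI x1 : D x1 \in I.
  rewrite /D (b_eqr _ (exp x1)) (lin_sum (br _)) big_seq memv_suml // => v ve.
  by rewrite (linZ (br _)) memvZ // De.
have gz0 x1 y1 : g (b x1 y1) z = 0 by rewrite gbz omI // omIr // oppr0 addr0.
move: (gpos zI); rewrite (lin_span0 (gl z) _ z1) ?ltxx //.
by move=> _ /allpairsP[p [_ _ ->]].
Qed.

End Kahler.

(** * Definiteness of the metric and Lefschetz injectivity on 2-forms *)

(** If [g u u < 0 < g v v], the quadratic polynomial [g (t u + v) (t u + v)] has
    two distinct real roots; both [t u + v] are in [I], and so is [u]. *)
Lemma anisotropic_definite (R : realType) (V : vectType R) (I : {vspace V})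
    (g : V -> V -> R) :
  (forall (a : R) x y z, g (a *: x + y) z = a * g x z + g y z) ->
  (forall x y, g x y = g y x) ->
  (forall x, x \notin I -> g x x != 0) ->
  (forall x, x \notin I -> 0 < g x x) \/ (forall x, x \notin I -> g x x < 0).
Proof.
move=> gl gC g0; apply: contrapT => /not_orP[/existsNP[u] + /existsNP[v]].
move=> /not_implyP[uI /negP gu] /not_implyP[vI /negP gv].
have {}gu : g u u < 0 by rewrite lt_neqAle g0 //= leNgt.
have {}gv : 0 < g v v by rewrite lt_neqAle eq_sym g0 //= leNgt.
pose s := Num.sqrt (g v u ^+ 2 - g v v * g u u).
have s0 : 0 < s by rewrite sqrtr_gt0; nra.
have ss : s ^+ 2 = g v u ^+ 2 - g v v * g u u by rewrite sqr_sqrtr //; nra.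
have gt t : g (t *: u + v) (t *: u + v) = g u u * t ^+ 2 + 2 * g v u * t + g v v.
  by rewrite gl (gC u (_ + _)) (gC v (_ + _)) !gl (gC u v); ring.
have root (d : R) : d ^+ 2 = s ^+ 2 -> ((- g v u + d) / g u u) *: u + v \in I.
  move=> ds; apply/negPn/negP => /g0; rewrite gt => /eqP[].
  have gn : g u u != 0 by rewrite lt_eqF.
  have -> : g u u * ((- g v u + d) / g u u) ^+ 2
      + 2 * g v u * ((- g v u + d) / g u u) + g v v
      = (d ^+ 2 - g v u ^+ 2 + g v v * g u u) / g u u by field.
  by rewrite ds ss; apply/eqP; rewrite mulf_eq0; apply/orP; left; apply/eqP; ring.
have h1 := root s erefl; have h2 := root (- s) (sqrrN s).
case/negP: uI; have := memvB h1 h2.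
rewrite opprD addrACA subrr addr0 -scalerBl => h.
have -> : u = ((2 * s / g u u)^-1 * ((- g v u + s) / g u u - (- g v u - s) / g u u)) *: u.
  rewrite (_ : _ * _ = 1) ?scale1r //; field.
  by rewrite (lt_eqF gu) (gt_eqF s0).
by rewrite -scalerA memvZ.
Qed.

Lemma common_kernel (R : realType) (V : vectType R) (I : {vspace V}) (k : nat)
    (f : 'I_k -> V -> R) :
  (forall i (a : R) x y, f i (a *: x + y) = a * f i x + f i y) ->
  (\dim I + k < \dim {:V})%N ->
  exists2 x, x \notin I & forall i, f i x = 0.
Proof.
move=> fl hd; pose L v : 'rV[R]_k := \row_i f i v.
have Ll : linear L by move=> a x y; apply/rowP => i; rewrite !mxE fl.
pose Lm := GRing.isLinear.Build _ _ _ _ L Ll.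
pose LL : {linear V -> 'rV[R]_k} := HB.pack L Lm.
pose F := linfun LL.
have /subvPn[x] : ~~ (lker F <= I)%VS.
  apply/negP => /dimvS h; have := limg_ker_dim F fullv.
  rewrite capfv; have := dimvS (subvf (limg F)); rewrite dimvf /dim /= mul1n; lia.
rewrite memv_ker lfunE /= => /eqP Lx xI; exists x => // i.
by have := congr1 (fun M : 'rV_k => M 0 i) Lx; rewrite !mxE.
Qed.

(** [Fom] says that the 4-form [F ^ om] is zero. *)
Section Lefschetz.
Variables (R : realType) (V : vectType R) (J : 'End(V)) (I : {vspace V}).
Variables (om F : V -> V -> R).
Hypothesis JJ : forall x, J (J x) = - x.
Hypothesis dimI : (\dim I + 4 < \dim {:V})%N.
Hypothesis om_lin : forall (a : R) x y z, om (a *: x + y) z = a * om x z + om y z.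
Hypothesis omC : forall x y, om x y = - om y x.
Hypothesis omJ : forall x y, om (J x) (J y) = om x y.
Hypothesis om_neq0 : forall x, x \notin I -> om x (J x) != 0.
Hypothesis Fom : forall x y z t,
  F x y * om z t - F x z * om y t + F x t * om y z
    + F y z * om x t - F y t * om x z + F z t * om x y = 0.

Let omJr u v : om u (J v) = - om (J u) v.
Proof.
have om0 w : om 0 w = 0 by have := om_lin 1 0 0 w; rewrite scale1r addr0; lra.
have := om_lin (-1) u 0 (J v); rewrite scaleN1r addr0 om0 -(JJ u) omJ; lra.
Qed.

(** The orthogonality conditions are four linear equations, and the space of
    solutions has larger dimension than [I]. *)
Lemma exists_perp x y : exists z,
  [/\ z \notin I, om x z = 0, om y z = 0, om x (J z) = 0 & om y (J z) = 0].
Proof.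
have [|z zI hz] := @common_kernel _ _ I 4
    (fun i z => om (nth 0 [:: x; y; J x; J y] i) z) _ dimI.
  by move=> i a u v; rewrite !(omC (nth _ _ _)) om_lin; ring.
exists z; split=> //; rewrite ?omJr.
- exact: (hz 0).
- exact: (hz 1).
- by rewrite (hz 2%:R) oppr0.
- by rewrite (hz 3%:R) oppr0.
Qed.

(** With [z] orthogonal to [x] and [y], the relation at [(x, y, z, J z)] expresses
    [F x y] by [F z (J z)].  With three mutually orthogonal complex lines, of
    [z], [e] and [f], the ratios [F z (J z) / om z (J z)] of any two lines are
    opposite to each other, hence all three are zero.  This is where complex
    dimension at least 3 modulo [I] is used. *)
Lemma lefschetz_injective2 x y : F x y = 0.
Proof.
have perp u v z : om u z = 0 -> om v z = 0 -> om u (J z) = 0 -> om v (J z) = 0 ->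
    F u v * om z (J z) + F z (J z) * om u v = 0.
  by move=> h1 h2 h3 h4; have := Fom u v z (J z); rewrite h1 h2 h3 h4; lra.
suff FJ z : z \notin I -> F z (J z) = 0.
  have [z [zI h1 h2 h3 h4]] := exists_perp x y.
  have := perp _ _ _ h1 h2 h3 h4; rewrite FJ // mul0r addr0 => /eqP.
  by rewrite mulf_eq0 (negPf (om_neq0 zI)) orbF => /eqP.
move=> zI.
have [e [eI ze Jze zJe JzJe]] := exists_perp z (J z).
have [f [fI zf ef zJf eJf]] := exists_perp z e.
have perpJ u v : om u v = 0 -> om u (J v) = 0 -> om (J u) v = 0 /\ om (J u) (J v) = 0.
  by move=> h1 h2; rewrite omJ -[om (J u) v]opprK -omJr h2 oppr0.
have [Jzf JzJf] := perpJ _ _ zf zJf; have [Jef JeJf] := perpJ _ _ ef eJf.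
have rel_ze := perp _ _ _ ze Jze zJe JzJe.
have rel_zf := perp _ _ _ zf Jzf zJf JzJf.
have rel_ef := perp _ _ _ ef Jef eJf JeJf.
have nz := om_neq0 zI; have ne := om_neq0 eI; have nf := om_neq0 fI.
have : 2 * om e (J e) * om f (J f) * F z (J z) = 0.
  transitivity (om f (J f) * (F z (J z) * om e (J e) + F e (J e) * om z (J z))
    + om e (J e) * (F z (J z) * om f (J f) + F f (J f) * om z (J z))
    - om z (J z) * (F e (J e) * om f (J f) + F f (J f) * om e (J e))); first by ring.
  by rewrite rel_ze rel_zf rel_ef; ring.
by move=> /eqP; rewrite !mulf_eq0 (negPf ne) (negPf nf) pnatr_eq0 /= => /eqP.
Qed.

End Lefschetz.

(** * Exclusion of 2-Kähler forms *)

Lemma ce_diff5 (R : realType) (V : vectType R) (b : lie_bracket V)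
    (w : ext_form V) x0 x1 x2 x3 x4 :
  ce_diff b w [:: x0; x1; x2; x3; x4] =
    - w [:: b x0 x1; x2; x3; x4] + w [:: b x0 x2; x1; x3; x4]
    - w [:: b x0 x3; x1; x2; x4] + w [:: b x0 x4; x1; x2; x3]
    - w [:: b x1 x2; x0; x3; x4] + w [:: b x1 x3; x0; x2; x4]
    - w [:: b x1 x4; x0; x2; x3] - w [:: b x2 x3; x0; x1; x4]
    + w [:: b x2 x4; x0; x1; x3] - w [:: b x3 x4; x0; x1; x2].
Proof.
rewrite /ce_diff /=.
under eq_bigr do rewrite big_mkcond.
rewrite !big_ord_recl !big_ord0 /= /bump /=.
rewrite /del2 /=.
rewrite !(addr0, add0r, add0n, addn0, add1n, addn1, exprS, expr0) /=.
ring.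
Qed.

(** If [om x (J x)] has no zero outside [I], then it has a constant sign, so [om] or
    its opposite is a Kähler form. *)
Lemma kahler_nilpotent (R : realType) (V : vectType R) (b : lie_bracket V)
    (J : complex_structure b) (I : {vspace V}) (om : V -> V -> R) :
  nilpotent_lie b ->
  (forall x y, x \in I -> b x y = 0) ->
  (forall x, x \in I -> J x \in I) ->
  (forall (a : R) x y z, om (a *: x + y) z = a * om x z + om y z) ->
  (forall x y, om x y = - om y x) ->
  (forall x y, om (J x) (J y) = om x y) ->
  (forall x y, x \in I -> om x y = 0) ->
  (forall x y z, om (b x y) z + om (b y z) x + om (b z x) y = 0) ->
  (forall x, x \notin I -> om x (J x) != 0) ->
  forall x y, b x y \in I.
Proof.
move=> nil Ic IJ ol oC oJ oI ocl on.
have ol2 (a : R) x y z : om x (a *: y + z) = a * om x y + om x z.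
  by rewrite oC ol (oC x y) (oC x z); ring.
have gC x y : om x (J y) = om y (J x).
  have -> : om x (J y) = - om (- y) (J x) by rewrite -(cplx_sq J) oJ (oC x).
  have := ol (-1) y 0 (J x); have := ol 1 0 0 (J x).
  by rewrite scale1r scaleN1r !addr0; lra.
case: (@anisotropic_definite _ V I (fun x y => om x (J y))) => //.
  by move=> pos x y; apply: (@definite_kahler_nilpotent _ _ b J I om).
move=> neg; apply: (@definite_kahler_nilpotent _ _ b J I (fun x y => - om x y)) => //.
- by move=> a x y z; rewrite ol; ring.
- by move=> x y; rewrite oC.
- by move=> x y; rewrite oJ.
- by move=> x y /oI->; rewrite oppr0.
- by move=> x y z; have := ocl x y z; lra.
- by move=> x /neg; rewrite oppr_gt0.
Qed.

Section TwoKahler.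
Variables (R : realType) (V : vectType R) (b : lie_bracket V).
Variables (J : complex_structure b) (n : nat) (Om : ext_form V) (X : V).
Hypothesis dimV : \dim {:V} = (2 * n)%N.
Hypothesis n4 : (8 <= 2 * n)%N.
Hypothesis nil : nilpotent_lie b.
Hypothesis X0 : X != 0.
Hypothesis bX : forall y, b X y = 0.
Hypothesis bJX : forall y, b (J X) y = 0.
Hypothesis HOm : p_kahler J n 2 Om.

Let I := <<[:: X; J X]>>%VS.
Let om y z : R := complex.Re (Om [:: X; J X; y; z]).

Let OF : is_form 4 Om.
Proof. by case: HOm => _ [/pq_form_form]. Qed.

Let OJ s : Om (map J s) = Om s.
Proof. case: HOm => _ [h _ _ _]. apply: (pq_form_J _ h). Qed.

Let Oreal s : Om s = (complex.Re (Om s))%:C.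
Proof.
case: HOm => _ [_ /(_ s) + _ _]; rewrite /form_conj.
case: (Om s) => u v /= [] h; apply/eqP; rewrite eq_complex /= eqxx /=; apply/eqP; lra.
Qed.

Let OC s1 s2 x y : Om (s1 ++ x :: y :: s2) = - Om (s1 ++ y :: x :: s2).
Proof. by have /formE[_ _ h] := OF; apply: h. Qed.

Let O_lin s1 s2 (a : R) x y :
  complex.Re (Om (s1 ++ (a *: x + y) :: s2))
  = a * complex.Re (Om (s1 ++ x :: s2)) + complex.Re (Om (s1 ++ y :: s2)).
Proof.
have /formE[_ h _] := OF; rewrite h Oreal [Om (s1 ++ y :: s2)]Oreal.
by rewrite [Om (s1 ++ x :: s2)]Oreal /=; ring.
Qed.

Let JI : Jstable J I.
Proof.
have -> : I = (<[X]> + <[J X]> + 0)%VS by rewrite /I !span_cons span_nil addvA.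
exact/Jstable_line/Jstable0/(cplx_sq J).
Qed.

Let om_lin (a : R) x y z : om (a *: x + y) z = a * om x z + om y z.
Proof. exact: (O_lin [:: X; J X] [:: z]). Qed.

Let ReN (z : R[i]) : complex.Re (- z) = - complex.Re z.
Proof. by case: z. Qed.

Let ReD (y z : R[i]) : complex.Re (y + z) = complex.Re y + complex.Re z.
Proof. by case: y z => [? ?] [? ?]. Qed.

Let omC x y : om x y = - om y x.
Proof. by rewrite /om (OC [:: X; J X]) ReN. Qed.

Let omJ x y : om (J x) (J y) = om x y.
Proof.
rewrite /om.
(* The invariance of Om under J, with X = J (- J X). *)
have -> : [:: X; J X; J x; J y] = map J [:: - J X; X; x; y].
  by rewrite /= linearN /= (cplx_sq J) opprK.
rewrite OJ (OC [::]) /= ReN -scaleN1r -[_ *: J X]addr0.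
rewrite (O_lin [:: X] [:: x; y]).
have [_ _ ha] := OF.
have := O_lin [:: X] [:: x; y] 1 0 0; rewrite scale1r addr0 /=; lra.
Qed.

Let omI x y : x \in I -> om x y = 0.
Proof.
have hl (a : R) u v : (om (a *: u + v) y : R^o) = a *: (om u y : R^o) + om v y.
  exact: om_lin.
apply: (lin_span0 hl) => v; have [_ _ ha] := OF.
rewrite !inE => /orP[]/eqP->; rewrite /om.
  by rewrite (ha [::] [:: J X] [:: y]).
by rewrite (ha [:: X] [::] [:: y]).
Qed.

Let om_neq0 x : x \notin I -> om x (J x) != 0.
Proof.
move=> xI.
have : Om [:: X; J X; x; J x] != 0.
  case: HOm => /andP[_ hn] [_ _ hT _].
  apply: (transverse_neq0 (cplx_sq J) _ dimV OF hT); first by lia.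
  have /perm_free-> : perm_eq [:: X; J X; x; J x] [:: J x; x; J X; X].
    by rewrite perm_sym -perm_rev.
  rewrite !free_cons nil_free andbT span_nil memv0 X0 andbT.
  have J0 := Jstable0 J; have JXI := J_notin_line (cplx_sq J).
  have := JXI 0%VS X J0; rewrite memv0 X0 addv0 span_seq1 => /(_ isT) ->.
  have E : <<[:: J X; X]>>%VS = I by rewrite /I !span_cons span_nil !addv0 addvC.
  by rewrite span_cons E xI !andbT; apply: JXI.
by rewrite Oreal (inj_eq (@complexI R)).
Qed.

Let bI x y : x \in I -> b x y = 0.
Proof.
have hl (a : R) u v : b (a *: u + v) y = a *: b u y + b v y by exact: bracket_linearl.
by apply: (lin_span0 hl) => v; rewrite !inE => /orP[]/eqP->.
Qed.

Let O0 s : Om (0 :: s) = 0.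
Proof. by have /formE[_ h _] := OF; apply: (multilinear0 [::] s h). Qed.

Let om_closed x y z : om (b x y) z + om (b y z) x + om (b z x) y = 0.
Proof.
case: HOm => _ [_ _ _ /(_ [:: X; J X; x; y; z])].
rewrite ce_diff5 !bX !bJX !O0.
have Orot u v : Om [:: u; X; J X; v] = Om [:: X; J X; u; v].
  by rewrite (OC [::]) /= (OC [:: X]) /= opprK.
rewrite !Orot => /(congr1 (@complex.Re R)); rewrite !(ReD, ReN).
rewrite -/(om _ _) -/(om _ _) -/(om _ _) (bracketC b z).
have hl (a : R) u v : (om (a *: u + v) y : R^o) = a *: (om u y : R^o) + om v y.
  exact: om_lin.
by rewrite (linN hl) /= oppr0 => h; lra.
Qed.

Let bracket_in x y : b x y \in I.
Proof. exact: (kahler_nilpotent nil bI JI om_lin omC omJ omI om_closed). Qed.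

Let T := [tuple X; J X].

Let b_coord x y : b x y = coord T ord0 (b x y) *: X + coord T ord_max (b x y) *: J X.
Proof.
have := coord_span (X := T) (bracket_in x y).
rewrite !big_ord_recl big_ord0 addr0 /= => {1}->.
by congr (_ *: _ + coord _ _ _ *: _); apply/val_inj.
Qed.

Let dim4 : (\dim I + 4 < \dim {:V})%N.
Proof. have := dim_span [:: X; J X]; rewrite dimV /= -/I; lia. Qed.

(** Closedness at [(P, u, v, z, t)] with [P] central says that the coordinate of
    the bracket along [J X] (for [P = X]) or along [X] (for [P = J X]) has zero
    wedge product with [om]. *)
Lemma p_kahler2_abelian x y : b x y = 0.
Proof.
have cl P u v z t : (forall y, b P y = 0) ->
    - complex.Re (Om [:: b u v; P; z; t]) + complex.Re (Om [:: b u z; P; v; t])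
    - complex.Re (Om [:: b u t; P; v; z]) - complex.Re (Om [:: b v z; P; u; t])
    + complex.Re (Om [:: b v t; P; u; z]) - complex.Re (Om [:: b z t; P; u; v]) = 0.
  move=> bP; case: HOm => _ [_ _ _ /(_ [:: P; u; v; z; t])].
  rewrite ce_diff5 !bP !O0 => /(congr1 (@complex.Re R)); rewrite !(ReD, ReN) /= oppr0.
  lra.
pose f i u v := coord T i (b u v).
have Orep P u v z t : complex.Re (Om [:: b u v; P; z; t])
    = f ord0 u v * complex.Re (Om [:: X; P; z; t])
      + f ord_max u v * complex.Re (Om [:: J X; P; z; t]).
  rewrite b_coord -[_ *: J X]addr0 !(O_lin [::] [:: P; z; t]) /= O0 /=.
  by rewrite addr0.
have Oeq P z t : complex.Re (Om [:: P; P; z; t]) = 0.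
  by have [_ _ ha] := OF; rewrite (ha [::] [::] [:: z; t]).
have OJX z t : complex.Re (Om [:: J X; X; z; t]) = - om z t by rewrite (OC [::]) ReN.
have f0 : f ord0 x y = 0.
  apply: (lefschetz_injective2 (cplx_sq J) dim4 om_lin omC omJ om_neq0) => u v z t.
  by have := cl (J X) u v z t bJX; rewrite !Orep !Oeq -!/(om _ _); lra.
have f1 : f ord_max x y = 0.
  apply: (lefschetz_injective2 (cplx_sq J) dim4 om_lin omC omJ om_neq0) => u v z t.
  by have := cl X u v z t bX; rewrite !Orep !Oeq !OJX; lra.
by rewrite b_coord -/(f _ _ _) -/(f _ _ _) f0 f1 !scale0r addr0.
Qed.

End TwoKahler.

Theorem theorem3p8 (R : realType) (g : vectType R) (b : lie_bracket g)
    (J : complex_structure b) (n : nat) :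
  \dim {:g} = (2 * n)%N ->
  (8 <= 2 * n)%N ->
  ~ abelian_lie b ->
  nilpotent_lie b ->
  quasi_nilpotent J ->
  ~ exists Om : ext_form g, p_kahler J n 2 Om.
Proof.
move=> dimg n8 nab nil qn [Om hOm]; apply: qn; apply/seteqP; split=> X /=; last first.
  move=> ->; rewrite linear0.
  by split=> y; apply: (lin0 (fun a x z => bracket_linearl b a x z y)).
move=> [bX bJX]; apply: contrapT => /eqP X0; apply: nab => x y.
exact: (p_kahler2_abelian dimg n8 nil X0 bX bJX hOm).
Qed.
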